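(* Let $S$ be a $\Gamma$-semiring with zero and with unities. If every member of $FLI(S)$ is a fuzzy left k-ideal, then the lattice $(FLI(S),\oplus,\cap)$ (join $\oplus$, meet $\cap$) is modular. Likewise, if every member of $FRI(S)$ is a fuzzy right k-ideal, then the lattice $(FRI(S),\oplus,\cap)$ is modular; and if every member of $FI(S)$ is a fuzzy k-ideal, then the lattice $(FI(S),\oplus,\cap)$ is modular.
   Context: Let $S$ and $\Gamma$ be additive commutative semigroups. $S$ is a $\Gamma$-semiring if there is a map $S\times\Gamma\times S\to S$, $(a,\alpha,b)\mapsto a\alpha b$, with $(a+b)\alpha c=a\alpha c+b\alpha c$, $a\alpha(b+c)=a\alpha b+a\alpha c$, $a(\alpha+\beta)b=a\alpha b+a\beta b$, $a\alpha(b\beta c)=(a\alpha b)\beta c$ for all $a,b,c\in S$, $\alpha,\beta\in\Gamma$. It is with zero if $(S,+)$ and $(\Gamma,+)$ are monoids with identities $0_S,0_\Gamma$ (both written $0$) and $0_S\alpha x=0_S=x\alpha 0_S$, $x0_\Gamma y=0_S=y0_\Gamma x$ for all $x,y\in S$, $\alpha\in\Gamma$. It is with unities if there are finite families $e_i\in S,\delta_i\in\Gamma$ with $\sum_i e_i\delta_i x=x$ for all $x\in S$ (left unity) and finite families $\nu_j\in\Gamma,f_j\in S$ with $\sum_j x\nu_j f_j=x$ for all $x\in S$ (right unity). A fuzzy subset of $S$ is a map $\mu:S\to[0,1]$; it is non empty if $\mu(x)\neq0$ for some $x$. A fuzzy left ideal (resp. fuzzy right ideal) of $S$ is a non empty fuzzy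 subset $\mu$ with $\mu(x+y)\ge\min[\mu(x),\mu(y)]$ and $\mu(x\gamma y)\ge\mu(y)$ (resp. $\mu(x\gamma y)\ge\mu(x)$) for all $x,y\in S,\gamma\in\Gamma$. A fuzzy ideal is both a fuzzy left and a fuzzy right ideal. Convention: all fuzzy left ideals, fuzzy right ideals and fuzzy ideals $\mu$ are assumed to satisfy $\mu(0)=1$. $FLI(S)$, $FRI(S)$, $FI(S)$ denote the sets of all fuzzy left ideals, fuzzy right ideals, fuzzy ideals of $S$ (with this convention). A fuzzy left ideal (resp. fuzzy right ideal, fuzzy ideal) $\mu$ is a fuzzy left k-ideal (resp. fuzzy right k-ideal, fuzzy k-ideal) if $\mu(x)\ge\min[\mu(x+y),\mu(y)]$ for all $x,y\in S$. The sets $FLI(S)$, $FRI(S)$, $FI(S)$ are ordered by $\mu\subseteq\nu$ iff $\mu(x)\le\nu(x)$ for all $x\in S$; each is a lattice with join $(\mu_1\oplus\mu_2)(x)=\sup\{\min[\mu_1(u),\mu_2(v)] : u,v\in S,\ x=u+v\}$ and meet $(\mu_1\cap\mu_2)(x)=\min[\mu_1(x),\mu_2(x)]$. *)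

(* Defs.v *)
From HB Require Import structures.
From mathcomp Require Import all_boot all_order all_algebra.
From mathcomp Require Import boolp classical_sets reals.

Set Implicit Arguments.
Unset Strict Implicit.
Unset Printing Implicit Defensive.

Import Order.TTheory GRing.Theory Num.Theory.
Local Open Scope ring_scope.
Local Open Scope classical_set_scope.

(* Gamma-semirings with zero: [nmodType] is the structure of additive
   commutative monoids. *)
HB.mixin Record Nmodule_isGammaSemiring (G : nmodType) S
    of GRing.Nmodule S := {
  gmul : S -> G -> S -> S;
  gmulDl : forall (a b c : S) (al : G),
    gmul (a + b) al c = gmul a al c + gmul b al c;
  gmulDr : forall (a b c : S) (al : G),
    gmul a al (b + c) = gmul a al b + gmul a al c;
  gmulDm : forall (a b : S) (al be : G),
    gmul a (al + be) b = gmul a al b + gmul a be b;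
  gmulA : forall (a b c : S) (al be : G),
    gmul a al (gmul b be c) = gmul (gmul a al b) be c;
  gmul0l : forall (x : S) (al : G), gmul 0 al x = 0;
  gmul0r : forall (x : S) (al : G), gmul x al 0 = 0;
  gmul0m : forall x y : S, gmul x 0 y = 0
}.

#[short(type="gammaSemiringType")]
HB.structure Definition GammaSemiring (G : nmodType) :=
  {S of GRing.Nmodule S & Nmodule_isGammaSemiring G S}.

Section Unities.
Variables (G : nmodType) (S : gammaSemiringType G).

Definition has_left_unity : Prop :=
  exists (n : nat) (e : 'I_n -> S) (de : 'I_n -> G),
    forall x : S, \sum_(i < n) gmul (e i) (de i) x = x.

Definition has_right_unity : Prop :=
  exists (n : nat) (nu : 'I_n -> G) (f : 'I_n -> S),
    forall x : S, \sum_(j < n) gmul x (nu j) (f j) = x.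

Definition has_unities : Prop := has_left_unity /\ has_right_unity.

End Unities.

Section FuzzyIdeals.
Variables (R : realType) (G : nmodType) (S : gammaSemiringType G).
Implicit Types mu : S -> R.

Definition fuzzy_subset mu : Prop := forall x, 0 <= mu x <= 1.

Definition fuzzy_nonempty mu : Prop := exists x, mu x != 0.

Definition fuzzy_left_ideal mu : Prop :=
  [/\ fuzzy_subset mu, fuzzy_nonempty mu,
      forall x y, Num.min (mu x) (mu y) <= mu (x + y)
    & forall x (ga : G) y, mu y <= mu (gmul x ga y)].

Definition fuzzy_right_ideal mu : Prop :=
  [/\ fuzzy_subset mu, fuzzy_nonempty mu,
      forall x y, Num.min (mu x) (mu y) <= mu (x + y)
    & forall x (ga : G) y, mu x <= mu (gmul x ga y)].

Definition fuzzy_ideal mu : Prop :=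
  fuzzy_left_ideal mu /\ fuzzy_right_ideal mu.

Definition k_condition mu : Prop :=
  forall x y, Num.min (mu (x + y)) (mu y) <= mu x.

Definition fuzzy_left_k_ideal mu : Prop :=
  fuzzy_left_ideal mu /\ k_condition mu.

Definition fuzzy_right_k_ideal mu : Prop :=
  fuzzy_right_ideal mu /\ k_condition mu.

Definition fuzzy_k_ideal mu : Prop := fuzzy_ideal mu /\ k_condition mu.

End FuzzyIdeals.

Section Operations.
Variables (R : realType) (S : nmodType).
Implicit Types mu nu : S -> R.

Definition fuzzy_le mu nu : Prop := forall x, mu x <= nu x.

Definition oplus mu nu : S -> R := fun x =>
  sup [set r | exists u v : S, x = u + v /\ r = Num.min (mu u) (nu v)].

Definition fcap mu nu : S -> R := fun x => Num.min (mu x) (nu x).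

Definition fuzzy_submonoid mu : Prop :=
  [/\ forall x, 0 <= mu x <= 1, mu 0 = 1
    & forall x y, Num.min (mu x) (mu y) <= mu (x + y)].

Lemma oplus_ge mu nu u v : fuzzy_submonoid mu -> fuzzy_submonoid nu ->
  Num.min (mu u) (nu v) <= oplus mu nu (u + v).
Proof.
move=> [mu01 _ _] _; apply: ub_le_sup; last by exists u, v.
exists 1 => _ [a [b [_ ->]]]; rewrite ge_min.
by have /andP[_ ->] := mu01 a.
Qed.

Lemma oplus_le mu nu x c :
  (forall u v, x = u + v -> Num.min (mu u) (nu v) <= c) -> oplus mu nu x <= c.
Proof.
move=> h; apply: ge_sup; last by move=> _ [u [v [xE ->]]]; apply: h.
by exists (Num.min (mu x) (nu 0)), x, 0; rewrite addr0.
Qed.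

Lemma oplus_gt mu nu x c : c < oplus mu nu x ->
  exists u v, [/\ x = u + v, c < mu u & c < nu v].
Proof.
move=> clt; apply: contrapT => h; move: clt; apply/negP; rewrite -leNgt.
apply: oplus_le => u v xE; rewrite leNgt lt_min; apply/negP => /andP[cu cv].
by apply: h; exists u, v.
Qed.

Lemma oplus_submonoid mu nu : fuzzy_submonoid mu -> fuzzy_submonoid nu ->
  fuzzy_submonoid (oplus mu nu).
Proof.
move=> hmu hnu; have [mu01 mu0 muD] := hmu; have [nu01 nu0 nuD] := hnu.
have le1 x : oplus mu nu x <= 1.
  apply: oplus_le => u v _; rewrite ge_min.
  by have /andP[_ ->] := mu01 u.
split.
- move=> x; rewrite le1 andbT; rewrite -[x]addr0.
  apply: le_trans (oplus_ge _ _ hmu hnu); rewrite le_min nu0 ler01 andbT.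
  by have /andP[] := mu01 x.
- apply/le_anti; rewrite le1 /= -[X in oplus _ _ X]addr0.
  by apply: le_trans (oplus_ge _ _ hmu hnu); rewrite mu0 nu0 minxx.
- move=> x y; rewrite leNgt; apply/negP; rewrite lt_min => /andP[].
  move=> /oplus_gt[u [v [xE cu cv]]] /oplus_gt[u' [v' [yE cu' cv']]].
  suff : oplus mu nu (x + y) < oplus mu nu (x + y) by rewrite ltxx.
  rewrite {2}xE {2}yE addrACA; apply: lt_le_trans (oplus_ge _ _ hmu hnu).
  rewrite lt_min; apply/andP; split.
    by apply: lt_le_trans (muD _ _); rewrite lt_min cu.
  by apply: lt_le_trans (nuD _ _); rewrite lt_min cv.
Qed.

Lemma fcap_submonoid mu nu : fuzzy_submonoid mu -> fuzzy_submonoid nu ->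
  fuzzy_submonoid (fcap mu nu).
Proof.
move=> [mu01 mu0 muD] [nu01 nu0 nuD]; split => [x||x y].
- have /andP[a b] := mu01 x; have /andP[c d] := nu01 x.
  by rewrite le_min ge_min a b c.
- by rewrite /fcap mu0 nu0 minxx.
- rewrite /fcap minACA le_min; apply/andP; split.
    by rewrite ge_min muD.
  by rewrite ge_min nuD orbT.
Qed.

Lemma oplus_sub mu nu (f : S -> S) : fuzzy_submonoid mu -> fuzzy_submonoid nu ->
  {morph f : x y / x + y} ->
  (forall x, mu x <= mu (f x)) -> (forall x, nu x <= nu (f x)) ->
  forall x, oplus mu nu x <= oplus mu nu (f x).
Proof.
move=> hmu hnu fD muf nuf x; apply: oplus_le => u v ->; rewrite fD.
apply: le_trans (oplus_ge _ _ hmu hnu).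
by rewrite le_min !ge_min muf nuf orbT.
Qed.

Lemma fcap_sub mu nu x y : mu x <= mu y -> nu x <= nu y ->
  fcap mu nu x <= fcap mu nu y.
Proof. by move=> h k; rewrite /fcap le_min !ge_min h k orbT. Qed.

End Operations.

(* A set of fuzzy subsets on which inclusion, [oplus] and [fcap] define a
   lattice; instantiated below to FLI, FRI and FI. *)
Record fuzzyFamily (R : realType) (S : nmodType) := FuzzyFamily {
  family_set : set (S -> R);
  family_submonoid : forall mu, family_set mu -> fuzzy_submonoid mu;
  family_oplus : forall mu nu,
    family_set mu -> family_set nu -> family_set (oplus mu nu);
  family_fcap : forall mu nu,
    family_set mu -> family_set nu -> family_set (fcap mu nu)
}.

Record fuzzyMember (R : realType) (S : nmodType) (F : fuzzyFamily R S) :=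
  FuzzyMember { fuzzy_val :> S -> R; fuzzy_valP : family_set F fuzzy_val }.

Fact fuzzy_display : Order.disp_t. Proof. exact: Order.Disp tt tt. Qed.

Section FuzzyLattice.
Variables (R : realType) (S : nmodType) (F : fuzzyFamily R S).
Local Notation T := (fuzzyMember F).
Implicit Types mu nu : T.

HB.instance Definition _ := gen_eqMixin T.
HB.instance Definition _ := gen_choiceMixin T.

Lemma fuzzy_val_inj : injective (@fuzzy_val R S F).
Proof. by move=> [f p] [g q] /= fg; subst g; rewrite (Prop_irrelevance p q). Qed.

Definition fm_le mu nu : bool := `[< fuzzy_le mu nu >].

Definition fm_join mu nu : T :=
  FuzzyMember (family_oplus (fuzzy_valP mu) (fuzzy_valP nu)).

Definition fm_meet mu nu : T :=
  FuzzyMember (family_fcap (fuzzy_valP mu) (fuzzy_valP nu)).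

Fact fm_le_refl : reflexive fm_le.
Proof. by move=> mu; apply/asboolP => x. Qed.

Fact fm_le_anti : antisymmetric fm_le.
Proof.
move=> mu nu /andP[/asboolP h /asboolP k]; apply: fuzzy_val_inj.
by apply/funext => x; apply/le_anti; rewrite h k.
Qed.

Fact fm_le_trans : transitive fm_le.
Proof.
move=> nu mu rho /asboolP h /asboolP k; apply/asboolP => x.
exact: le_trans (h x) (k x).
Qed.

HB.instance Definition _ := Order.Le_isPOrder.Build fuzzy_display T
  fm_le_refl fm_le_anti fm_le_trans.

Fact fm_meetP mu nu rho :
  (mu <= fm_meet nu rho)%O = (mu <= nu)%O && (mu <= rho)%O.
Proof.
apply/asboolP/andP => [h|[/asboolP h /asboolP k] x].
  by split; apply/asboolP => x; have := h x;
    rewrite /= /fcap le_min => /andP[].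
by rewrite /= /fcap le_min h k.
Qed.

Fact fm_joinP mu nu rho :
  (fm_join mu nu <= rho)%O = (mu <= rho)%O && (nu <= rho)%O.
Proof.
have hmu := family_submonoid (fuzzy_valP mu).
have hnu := family_submonoid (fuzzy_valP nu).
have [_ _ rhoD] := family_submonoid (fuzzy_valP rho).
have [mu01 mu0 _] := hmu; have [nu01 nu0 _] := hnu.
apply/asboolP/andP => [h|[/asboolP h /asboolP k] x].
  split; apply/asboolP => x; apply: le_trans (h x).
    rewrite -[X in _ <= fuzzy_val _ X]addr0.
    apply: le_trans (oplus_ge _ _ hmu hnu).
    by rewrite le_min lexx nu0; have /andP[_ ->] := mu01 x.
  rewrite -[X in _ <= fuzzy_val _ X]add0r.
  apply: le_trans (oplus_ge _ _ hmu hnu).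
  by rewrite le_min lexx mu0; have /andP[_ ->] := nu01 x.
apply: oplus_le => u v ->; apply: le_trans (rhoD _ _).
by rewrite le_min !ge_min h k orbT.
Qed.

HB.instance Definition _ := Order.POrder_MeetJoin_isLattice.Build
  fuzzy_display T fm_meetP fm_joinP.

Lemma fuzzy_leP mu nu : reflect (fuzzy_le mu nu) (mu <= nu)%O.
Proof. exact: asboolP. Qed.

Lemma fuzzy_joinE mu nu : (mu `|` nu)%O = oplus mu nu :> (S -> R).
Proof. by []. Qed.

Lemma fuzzy_meetE mu nu : (mu `&` nu)%O = fcap mu nu :> (S -> R).
Proof. by []. Qed.

End FuzzyLattice.

Section Families.
Variables (R : realType) (G : nmodType) (S : gammaSemiringType G).
Implicit Types mu nu : S -> R.

Definition FLI_set : set (S -> R) :=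
  [set mu | fuzzy_left_ideal mu /\ mu 0 = 1].

Definition FRI_set : set (S -> R) :=
  [set mu | fuzzy_right_ideal mu /\ mu 0 = 1].

Definition FI_set : set (S -> R) :=
  [set mu | fuzzy_ideal mu /\ mu 0 = 1].

Fact FLI_setE mu : FLI_set mu <-> fuzzy_submonoid mu /\
  forall x (ga : G) y, mu y <= mu (gmul x ga y).
Proof.
split=> [[[h1 _ h2 h3] h0]|[[h1 h0 h2] h3]] //.
by split=> //; split=> //; exists 0; rewrite h0 oner_neq0.
Qed.

Fact FRI_setE mu : FRI_set mu <-> fuzzy_submonoid mu /\
  forall x (ga : G) y, mu x <= mu (gmul x ga y).
Proof.
split=> [[[h1 _ h2 h3] h0]|[[h1 h0 h2] h3]] //.
by split=> //; split=> //; exists 0; rewrite h0 oner_neq0.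
Qed.

Fact FI_setE mu : FI_set mu <-> FLI_set mu /\ FRI_set mu.
Proof. by split=> [[[]]|[[? ?] []]]. Qed.

Fact FLI_submonoid mu : FLI_set mu -> fuzzy_submonoid mu.
Proof. by move=> /FLI_setE[]. Qed.

Fact FLI_oplus mu nu : FLI_set mu -> FLI_set nu -> FLI_set (oplus mu nu).
Proof.
move=> /FLI_setE[h1 h2] /FLI_setE[k1 k2]; apply/FLI_setE; split.
  exact: oplus_submonoid.
move=> x ga; apply: (@oplus_sub R S mu nu (gmul x ga)) => // a b.
exact: gmulDr.
Qed.

Fact FLI_fcap mu nu : FLI_set mu -> FLI_set nu -> FLI_set (fcap mu nu).
Proof.
move=> /FLI_setE[h1 h2] /FLI_setE[k1 k2]; apply/FLI_setE; split.
  exact: fcap_submonoid.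
by move=> x ga y; apply: fcap_sub.
Qed.

Fact FRI_submonoid mu : FRI_set mu -> fuzzy_submonoid mu.
Proof. by move=> /FRI_setE[]. Qed.

Fact FRI_oplus mu nu : FRI_set mu -> FRI_set nu -> FRI_set (oplus mu nu).
Proof.
move=> /FRI_setE[h1 h2] /FRI_setE[k1 k2]; apply/FRI_setE; split.
  exact: oplus_submonoid.
move=> x ga y; apply: (@oplus_sub R S mu nu (fun z => gmul z ga y)) => // a b.
exact: gmulDl.
Qed.

Fact FRI_fcap mu nu : FRI_set mu -> FRI_set nu -> FRI_set (fcap mu nu).
Proof.
move=> /FRI_setE[h1 h2] /FRI_setE[k1 k2]; apply/FRI_setE; split.
  exact: fcap_submonoid.
by move=> x ga y; apply: fcap_sub.
Qed.

Fact FI_submonoid mu : FI_set mu -> fuzzy_submonoid mu.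
Proof. by move=> /FI_setE[/FLI_submonoid]. Qed.

Fact FI_oplus mu nu : FI_set mu -> FI_set nu -> FI_set (oplus mu nu).
Proof.
move=> /FI_setE[h1 h2] /FI_setE[k1 k2]; apply/FI_setE.
by split; [apply: FLI_oplus|apply: FRI_oplus].
Qed.

Fact FI_fcap mu nu : FI_set mu -> FI_set nu -> FI_set (fcap mu nu).
Proof.
move=> /FI_setE[h1 h2] /FI_setE[k1 k2]; apply/FI_setE.
by split; [apply: FLI_fcap|apply: FRI_fcap].
Qed.

Definition FLI : Type :=
  fuzzyMember (FuzzyFamily FLI_submonoid FLI_oplus FLI_fcap).
HB.instance Definition _ := Order.Lattice.on FLI.

Definition FRI : Type :=
  fuzzyMember (FuzzyFamily FRI_submonoid FRI_oplus FRI_fcap).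
HB.instance Definition _ := Order.Lattice.on FRI.

Definition FI : Type :=
  fuzzyMember (FuzzyFamily FI_submonoid FI_oplus FI_fcap).
HB.instance Definition _ := Order.Lattice.on FI.

End Families.

Arguments FLI R {G} S.
Arguments FRI R {G} S.
Arguments FI R {G} S.

Definition modular_lattice d (L : latticeType d) : Prop :=
  forall x y z : L, (x <= z)%O -> (x `|` (y `&` z) = (x `|` y) `&` z)%O.

(* Main.v *)
(** If [a = u + v] with [x u], [y v] and [z a] all above a level [c], then
    [z u >= x u > c] because [x <= z], so the k-condition on [z] forces
    [z v > c]. The same decomposition therefore witnesses that
    [x (+) (y cap z)] is above [c] at [a]. *)
Require Import Defs.
From mathcomp Require Import all_boot all_order all_algebra.
From mathcomp Require Import boolp classical_sets reals.

Import Order.TTheory.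

Lemma fcap_oplus_le (R : realType) (G : nmodType)
    (S : gammaSemiringType G) (x y z : S -> R) :
  fuzzy_submonoid x -> fuzzy_submonoid y -> fuzzy_submonoid z ->
  k_condition z -> fuzzy_le x z ->
  fuzzy_le (fcap (oplus x y) z) (oplus x (fcap y z)).
Proof.
(* The supremum in [oplus] need not be attained, so the level is the right-hand value at [a],
   assumed strictly smaller: strictness yields an actual decomposition of [a]. *)
move=> hx hy hz kz xz a; rewrite leNgt; apply/negP.
rewrite {2}/fcap lt_min => /andP[/oplus_gt[u [v [aE cu cv]]]].
rewrite {2}aE => ca; have cz : (oplus x (fcap y z) a < z v)%R.
  apply: lt_le_trans (kz v u).
  by rewrite GRing.addrC lt_min ca (lt_le_trans cu (xz u)).
suff : (oplus x (fcap y z) a < oplus x (fcap y z) a)%R by rewrite ltxx.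
rewrite {2}aE; apply: lt_le_trans (oplus_ge u v hx (fcap_submonoid hy hz)).
by rewrite /fcap !lt_min cu cv cz.
Qed.

(** Abstracting over the family lets one argument serve left, right and two-sided ideals. *)
Lemma fuzzy_modular (R : realType) (G : nmodType)
    (S : gammaSemiringType G) (F : fuzzyFamily R S) :
  (forall mu : fuzzyMember F, k_condition mu) ->
  modular_lattice (fuzzyMember F).
Proof.
move=> kF x y z xz; apply/le_anti/andP; split.
  (* This half of the modular law holds in every lattice. *)
  by rewrite lexI leU2 ?leIl // leUx xz leIr.
by apply/fuzzy_leP/fcap_oplus_le; [exact: (family_submonoid (fuzzy_valP _))..
  |exact: kF|exact/fuzzy_leP].
Qed.

Theorem proposition3p17 (R : realType) (G : nmodType) (S : gammaSemiringType G)
    (unitS : has_unities S) :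
  [/\ (forall mu : FLI R S, fuzzy_left_k_ideal mu) -> modular_lattice (FLI R S),
      (forall mu : FRI R S, fuzzy_right_k_ideal mu) -> modular_lattice (FRI R S)
    & (forall mu : FI R S, fuzzy_k_ideal mu) -> modular_lattice (FI R S)].
Proof.
by split=> kS; apply: fuzzy_modular => mu; have [] := kS mu.
Qed.
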